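(* Let $\upsilon$ be the uniform distribution on $\mathcal{W}_n$ and let $T_\upsilon(n)=\sum_{w\in\mathcal{W}_n}\upsilon(w)\,\mathbb{E}(T\mid w_0=w)$ be the uniformly-weighted expected convergence time of the cooling process. Then $T_\upsilon(n)=O(n^{5/2}\ln n)$.
   Context: A configuration of length $n$ is a word $w=w_1\cdots w_n$ over $\{1,2\}$ with $|w|_1=|w|_2$; $\mathcal{W}_n$ is the set of such words. A flip at position $1\le i<n$ exchanges $w_i$ and $w_{i+1}$ when $w_i\ne w_{i+1}$. $E(w)$ is the number of indices $i$ with $w_i=w_{i+1}$ (mismatches). The cooling process is the Markov chain $(w_t)_{t\ge0}$ on $\mathcal{W}_n$ started at $w_0$, with $w_{t+1}=w_t$ if $E(w_t)=0$, and otherwise $w_{t+1}$ obtained by performing a flip chosen uniformly at random among the flips on $w_t$ that do not increase $E$. The convergence time is $T=\min\{t\ge0: E(w_t)=0\}$. *)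

(* Defs.v *)
From HB Require Import structures.
From mathcomp Require Import all_boot all_order all_algebra.
From mathcomp Require Import all_classical all_reals all_analysis.
Set Implicit Arguments. Unset Strict Implicit. Unset Printing Implicit Defensive.
Import Order.TTheory GRing.Theory Num.Theory.
Local Open Scope ring_scope.

(* Words of length n over the two-letter alphabet {1,2}, encoded as
   booleans: letter 1 = false, letter 2 = true. *)
Definition word (n : nat) := n.-tuple bool.

Definition letter n (w : word n) (i : nat) : bool := nth false w i.

Definition configs (n : nat) : {set word n} :=
  [set w : word n | count negb w == count id w].

(* E(w) : number of indices i (1 <= i < n, here 0 <= i < n-1) with w_i = w_{i+1} *)
Definition mism n (w : word n) : nat :=
  \sum_(0 <= i < n.-1) (letter w i == letter w i.+1).

Definition swapi (i k : nat) : nat :=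
  if k == i then i.+1 else if k == i.+1 then i else k.

Definition flip n (w : word n) (i : nat) : word n :=
  [tuple letter w (swapi i k) | k < n].

Definition good_flips n (w : word n) : seq nat :=
  [seq i <- iota 0 n.-1 |
     (letter w i != letter w i.+1) && (mism (flip w i) <= mism w)%N].

Definition trans (R : realType) n (v v' : word n) : R :=
  if (mism v == 0)%N || (size (good_flips v) == 0)%N then (v == v')%:R
  else (count (fun i => flip v i == v') (good_flips v))%:R
       / (size (good_flips v))%:R.

(* surv t w v = P(w_t = v and E(w_s) <> 0 for all s <= t | w_0 = w) *)
Fixpoint surv (R : realType) n (t : nat) (w v : word n) : R :=
  match t with
  | 0 => ((v == w) && (mism v != 0)%N)%:R
  | t'.+1 => (mism v != 0)%N%:R *
             \sum_(u : word n) surv R t' w u * trans R u v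
  end.

Definition tail_prob (R : realType) n (t : nat) (w : word n) : R :=
  \sum_(v : word n) surv R t w v.

(* E(T | w_0 = w) = sum_{t >= 0} P(T > t | w_0 = w), in extended reals
   (equal to +oo when T is infinite with positive probability). *)
Definition exp_time (R : realType) n (w : word n) : \bar R :=
  (\sum_(t <oo) (tail_prob R t w)%:E)%E.

Definition T_unif (R : realType) (n : nat) : \bar R :=
  (\sum_(w in configs n) (#|configs n|%:R^-1 : R)%:E * exp_time R w)%E.

(* Main.v *)
Require Import Defs.
From HB Require Import structures.
From mathcomp Require Import all_boot all_order all_algebra perm.
From mathcomp Require Import all_classical all_reals all_analysis.
From mathcomp Require Import zify ring lra.
Import Order.TTheory GRing.Theory Num.Theory.
Local Open Scope ring_scope.
Set Implicit Arguments. Unset Strict Implicit. Unset Printing Implicit Defensive.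

(* A word is a lattice path, and a mismatch is a vertex where the path goes
   straight through its level [k]. For [k >= 0] the edges lying above level [k]
   form runs, for [k < 0] those lying below, and the mismatches of level [k] are
   the ends of these runs. A flip that does not increase E moves one end of a
   run by two edges, deletes a run of length 2, or merges two runs.
   The potential is the sum of [F L] over all runs at all levels, where [L] is
   the length and [F L = 2K + K L - L^2] with [K = 2n + 2]. Were all moves of
   all ends possible, the potential would change by [-8] in total per mismatch,
   by concavity of [F]. Two adjacent mismatches block each other, but then either
   the runs are nested and concavity makes the two missing moves harmless, or
   both missing moves would enlarge a run. The constant [2K] makes deletions and
   mergings harmless. As there are at most two flips per mismatch, each step
   decreases the potential by at least 4 on average, so that E(T) is at most a
   quarter of the initial potential, which is O(n) times the area between the
   path and the axis. Under the uniform distribution two letters are negatively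
   correlated, so heights have variance at most [n] and the mean area is
   O(n^(3/2)). *)

(** * Weighted sums over the runs of a boolean sequence *)

Section Runs.
Variable F : nat -> int.

Fixpoint lrun (b : nat -> bool) (p : nat) : nat :=
  if p is p'.+1 then if b p' then (lrun b p').+1 else 0 else 0.

Fixpoint rrun (b : nat -> bool) (p k : nat) : nat :=
  if k is k'.+1 then if b p then (rrun b p.+1 k').+1 else 0 else 0.

(** The sum of [F] over maximal runs, telescoped: [a] counts the edges of the current run already
    read, and each further edge adds one increment. When [F 0 = 0], a run read from its start
    contributes [F] of its length. *)
Fixpoint runsum_from (b : nat -> bool) (p k a : nat) : int :=
  if k is k'.+1 then
    if b p then F a.+1 - F a + runsum_from b p.+1 k' a.+1
    else runsum_from b p.+1 k' 0
  else 0.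

Definition runsum (b : nat -> bool) (n : nat) : int := runsum_from b 0 n 0.

Lemma lrun_le b p : (lrun b p <= p)%N.
Proof. by elim: p => //= p IH; case: (b p). Qed.

Lemma rrun_le b p k : (rrun b p k <= k)%N.
Proof. by elim: k p => //= k IH p; case: (b p) => //; apply: IH. Qed.

Lemma lrun_ext b b' p : (forall e, (e < p)%N -> b e = b' e) -> lrun b p = lrun b' p.
Proof.
elim: p => //= p IH H; rewrite H // IH // => e he; apply: H; exact: ltnW.
Qed.

Lemma rrun_ext b b' p k :
  (forall e, (p <= e < p + k)%N -> b e = b' e) -> rrun b p k = rrun b' p k.
Proof.
elim: k p => //= k IH p H; rewrite H; last by lia.
by rewrite (IH p.+1) // => e he; apply: H; lia.
Qed.

Lemma runsum_from_ext b b' p k a :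
  (forall e, (p <= e < p + k)%N -> b e = b' e) ->
  runsum_from b p k a = runsum_from b' p k a.
Proof.
elim: k p a => //= k IH p a H; rewrite H; last by lia.
have H' e : (p.+1 <= e < p.+1 + k)%N -> b e = b' e by move=> he; apply: H; lia.
by rewrite !(IH p.+1 _ H').
Qed.

(** Only the run starting at [p] sees the counter: it contributes [F (a + r) - F a] in place of
    [F r]. *)
Lemma runsum_from0 b p k a : F 0%N = 0 ->
  runsum_from b p k a
  = runsum_from b p k 0 + F (a + rrun b p k)%N - F a - F (rrun b p k).
Proof.
move=> F0; elim: k p a => /= [|k IH] p a; first by rewrite addn0 F0; lia.
case: (b p); last first.
  by rewrite addn0 F0; ring.
rewrite (IH p.+1 a.+1) (IH p.+1 1%N) F0 !add1n addSnnS; lia.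
Qed.

Lemma runsum_cat b p k :
  runsum b (p + k) = runsum b p + runsum_from b p k (lrun b p).
Proof.
rewrite /runsum.
(* The induction needs any start and any counter; the counter reached is an iteration, recognised as
   [lrun] at the end. *)
have gen q a : runsum_from b q (p + k) a = runsum_from b q p a +
   runsum_from b (q + p) k
     (iteri p (fun i c => if b (q + i)%N then c.+1 else 0%N) a).
  elim: p q a => [|p IH] q a /=; first by rewrite addn0 add0n add0r.
  have st c : iteri p.+1 (fun i c => if b (q + i)%N then c.+1 else 0%N) c
     = iteri p (fun i c => if b (q.+1 + i)%N then c.+1 else 0%N)
         (if b q then c.+1 else 0%N).
    elim: (p) => [|p' IHp] /=; first by rewrite addn0.
    by move: IHp => /= ->; rewrite addnS addSn.
  move: (st a) => /= ->.
  by case: (b q); rewrite IH addSnnS; lia.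
rewrite (gen 0%N 0%N) add0n; congr (_ + runsum_from b p k _).
by elim: (p) => //= p' ->; rewrite add0n.
Qed.

(** The two new edges join the runs on both sides. As [F 0 = 0], either side may be empty, so
    creation, growth and merging share one formula. *)
Lemma runsum_domino b b' i k : F 0%N = 0 ->
  (forall e, (e < i + 2 + k)%N -> e != i -> e != i.+1 -> b e = b' e) ->
  ~~ b i -> ~~ b i.+1 -> b' i -> b' i.+1 ->
  runsum b' (i + 2 + k) - runsum b (i + 2 + k) =
  F (lrun b i + rrun b (i + 2) k + 2)%N - F (lrun b i) - F (rrun b (i + 2) k).
Proof.
move=> F0 H bi bi1 b'i b'i1.
rewrite -!addnA !runsum_cat /=.
rewrite (negbTE bi) (negbTE bi1) b'i b'i1.
have Hl e : (e < i)%N -> b e = b' e by move=> he; apply: H; lia.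
have Hr e : (i.+2 <= e < i.+2 + k)%N -> b e = b' e by move=> he; apply: H; lia.
rewrite -(lrun_ext Hl).
have -> : runsum b i = runsum b' i by apply: runsum_from_ext => e he; apply: Hl; lia.
rewrite -(@runsum_from_ext b b' i.+2 k _ Hr) (runsum_from0 b i.+2 k (_.+2) F0).
rewrite (_ : (i + 2 = i.+2)%N); last by lia.
rewrite (_ : ((lrun b i).+2 + rrun b i.+2 k = lrun b i + (rrun b i.+2 k + 2))%N); last by lia.
rewrite add0n; lia.
Qed.

Lemma runsum_bounds (C : int) b n :
  (forall j, (j < n)%N -> 0 <= F j.+1 - F j <= C) ->
  0 <= runsum b n <= C * \sum_(e < n) (b e : nat)%:Z.
Proof.
move=> HF.
have gen p k a : (a + k <= n)%N ->
   0 <= runsum_from b p k a <= C * \sum_(e < k) (b (p + e)%N : nat)%:Z.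
  elim: k p a => [|k IH] p a Hk /=; first by rewrite big_ord0 mulr0.
  have -> : \sum_(e < k.+1) (b (p + e)%N : nat)%:Z =
      (b p)%:Z + \sum_(e < k) (b (p.+1 + e)%N : nat)%:Z.
    rewrite big_ord_recl addn0; congr (_ + _).
    by apply: eq_bigr => e _; rewrite /= /bump /= add1n addnS addSn.
  rewrite mulrDr; have [HFa HFb] := andP (HF a ltac:(lia)).
  case: (b p) => /=.
    have -> : C * 1%:Z = C by lia.
    by move: (IH p.+1 a.+1 ltac:(lia)); move: (C * \sum_(e < k) _) => S; lia.
  have -> : C * 0%:Z = 0 by lia.
  by move: (IH p.+1 0%N ltac:(lia)); move: (C * \sum_(e < k) _) => S; lia.
have := gen 0%N n 0%N (leqnn _).
by under eq_bigr do rewrite add0n.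
Qed.

End Runs.

(** Shifted one edge to the left, the run of [b'] before [p] lies inside [b], and edge [p.-1]
    prolongs it. Since [b' 0] is false, there is room for the shift. *)
Lemma lrun_nested (b b' : nat -> bool) p : (0 < p)%N -> b p.-1 -> ~~ b' 0%N ->
  (forall e, (0 < e < p)%N -> b' e -> b e.-1) ->
  (lrun b' p < lrun b p)%N.
Proof.
elim: p => // p IH _ /= bp b'0 H; rewrite bp ltnS.
case E: (b' p) => //.
case: p => [|p] in IH bp H E *; first by rewrite E in b'0.
have bp' := H p.+1 (ltnSn _) E.
by apply: IH => // e he; apply: H; lia.
Qed.

Lemma rrun_nested (b b' : nat -> bool) p k : (0 < k)%N -> b p -> ~~ b' (p + k).-1 ->
  (forall e, (e.+1 < p + k)%N -> b' e -> b e.+1) ->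
  (rrun b' p k < rrun b p k)%N.
Proof.
elim: k p => // k IH p _ /= bp b'0 H; rewrite bp ltnS.
case E: (b' p) => //.
case: k => [|k] in IH b'0 H *; first by rewrite addn1 /= E in b'0.
apply: IH => //.
- by apply: H => //; lia.
- by rewrite addSnnS.
by move=> e he; apply: H; lia.
Qed.

(** * The concave weight of a run *)

Definition wt (K L : nat) : int :=
  if L is 0 then 0 else 2 * K%:Z + K%:Z * L%:Z - L%:Z * L%:Z.

Lemma wt_grow K l : (0 < l)%N -> wt K (l + 2) - wt K l = 2 * K%:Z - 4 * l%:Z - 4.
Proof. by case: l => // l _; rewrite /wt addSn; lia. Qed.

Lemma wt_two K : wt K 2 = 4 * K%:Z - 4.
Proof. rewrite /wt; lia. Qed.

(** Merging saves one constant [2K], which pays for the two added edges at [K] each; the squares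
    only help. *)
Lemma wt_merge K l r : (0 < l)%N -> (0 < r)%N -> wt K (l + r + 2) <= wt K l + wt K r.
Proof. case: l r => // l [|r] // _ _; rewrite /wt !addSn; nia. Qed.

(** For [K = 2n + 2] the increments [K - 2j - 1] stay positive up to length [n]; the largest
    increment is the creation of a run, [3K - 1]. *)
Lemma wt_step n j : (j < n)%N ->
  0 <= wt (2 * n + 2) j.+1 - wt (2 * n + 2) j <= 3 * (2 * n + 2)%:Z.
Proof. move=> jn; case: j jn => [|j] jn; rewrite /wt; nia. Qed.

(** * The potential *)

Fixpoint height (a : nat -> bool) (x : nat) : int :=
  if x is x'.+1 then height a x' + (if a x' then 1 else -1) else 0.

Definition low (a : nat -> bool) (e : nat) : int :=
  if a e then height a e else height a e - 1.

(** [low] is the lower end of an edge. The side taken is the one facing away from the axis, so that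
    the counts over all levels add up to about the area. *)
Definition side (a : nat -> bool) (k : int) (e : nat) : bool :=
  if 0 <= k then k <= low a e else low a e < k.

Definition potential (n : nat) (a : nat -> bool) : int :=
  \sum_(j < n.+1) runsum (wt (2 * n + 2)) (side a j%:Z) n
  + \sum_(j < n) runsum (wt (2 * n + 2)) (side a (Negz j)) n.

Lemma heightS a x : height a x.+1 = height a x + (if a x then 1 else -1).
Proof. by []. Qed.

Lemma height_ext a a' x : (forall e, (e < x)%N -> a e = a' e) -> height a x = height a' x.
Proof.
elim: x => //= x IH H; rewrite H // IH // => e he; apply: H; exact: ltnW.
Qed.

Lemma height_bound a x : `|height a x| <= x%:Z.
Proof. by elim: x => //= x IH; case: (a x); lia. Qed.

(** * Effect of a flip on heights, sides and the potential *)

Section Swap.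
Variables (a : nat -> bool) (i : nat).
Hypothesis ai : a i != a i.+1.
Let a' k := a (swapi i k).

Lemma height_swap x : x != i.+1 -> height a' x = height a x.
Proof.
have lo y : (y <= i)%N -> height a' y = height a y.
  move=> yi; apply: height_ext => e he; rewrite /a' /swapi.
  by rewrite !ifN_eq //; lia.
case: (leqP x i) => [/lo//|xi] xn.
rewrite -(subnKC (_ : i.+2 <= x)%N); last by lia.
elim: (x - i.+2)%N => [|d IH].
  rewrite addn0 /= lo // /a' /swapi eqxx ifN_eq ?eqxx; last by lia.
  by move: ai; case: (a i); case: (a i.+1) => // _; lia.
by rewrite addnS [LHS]heightS [RHS]heightS IH /a' /swapi !ifN_eq //; lia.
Qed.

Lemma low_swap e :
  low a' e = if (e == i) || (e == i.+1) then low a i + (if a i then -1 else 1)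
             else low a e.
Proof.
rewrite /low; case: (eqVneq e i) => [->|ei] /=.
  rewrite height_swap; last by lia.
  by rewrite /a' /swapi eqxx; move: ai; case: (a i); case: (a i.+1) => // _; lia.
case: (eqVneq e i.+1) => [->|ei1] /=.
  rewrite height_swap; last by lia.
  rewrite /a' /swapi !eqxx ifN_eq; last by lia.
  by move: ai; case: (a i); case: (a i.+1) => // _; lia.
by rewrite height_swap // /a' /swapi !ifN_eq //.
Qed.

End Swap.

Lemma height_bump a i : a i != a i.+1 -> height a i.+2 = height a i.
Proof. by rewrite /=; case: (a i); case: (a i.+1) => // _; lia. Qed.

(** A flip moves its two edges by one unit, which crosses a single level: the common height of
    vertices [i] and [i.+2]. *)
Lemma side_swap_neq a i k e : a i != a i.+1 -> k != height a i ->
  side (fun x => a (swapi i x)) k e = side a k e.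
Proof.
move=> ai ki; rewrite /side low_swap //.
have li : low a i.+1 = low a i.
  by move: ai; rewrite /low /=; case: (a i); case: (a i.+1) => // _; lia.
have lih : low a i = if a i then height a i else height a i - 1 by [].
case: eqVneq => [->|ei] /=; last case: eqVneq => [->|ei1] //=; rewrite ?li lih.
  by case: (a i); case: (0 <= _); lia.
by case: (a i); case: (0 <= _); lia.
Qed.

Lemma side_swap_eq a i e : a i != a i.+1 ->
  side (fun x => a (swapi i x)) (height a i) e =
  side a (height a i) e (+) ((e == i) || (e == i.+1)).
Proof.
move=> ai; rewrite /side low_swap //.
have li : low a i.+1 = low a i.
  by move: ai; rewrite /low /=; case: (a i); case: (a i.+1) => // _; lia.
have lih : low a i = if a i then height a i else height a i - 1 by [].
case: eqVneq => [->|ei] /=; last case: eqVneq => [->|ei1] //=; rewrite ?li ?lih ?addbF //.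
  by case: (a i); case: (0 <= _); lia.
by case: (a i); case: (0 <= _); lia.
Qed.

Lemma side_peak a i : a i != a i.+1 ->
  side a (height a i) i.+1 = side a (height a i) i.
Proof.
move=> ai; rewrite /side; suff -> : low a i.+1 = low a i by [].
by move: ai; rewrite /low /=; case: (a i); case: (a i.+1) => // _; lia.
Qed.

(** Only the level [height a i] changes. There the two edges either leave a run, cutting it into [l]
    and [r], or fill the gap between two runs. *)
Lemma potential_swap n a i : (i.+1 < n)%N -> a i != a i.+1 ->
  let b := side a (height a i) in
  let l := lrun b i in
  let r := rrun b (i + 2) (n - (i + 2)) in
  let W := wt (2 * n + 2) in
  potential n (fun x => a (swapi i x)) - potential n a =
  if b i then W l + W r - W (l + r + 2)%N else W (l + r + 2)%N - W l - W r.
Proof.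
move=> in_ ai b l r W.
set a' := fun x => a (swapi i x).
pose D k := runsum W (side a' k) n - runsum W (side a k) n.
have D0 k : k != height a i -> D k = 0.
  move=> ki; apply/eqP; rewrite subr_eq0; apply/eqP; apply: runsum_from_ext => e _.
  exact: side_swap_neq.
have -> : potential n a' - potential n a = D (height a i).
  rewrite /potential opprD addrACA -!sumrB.
  rewrite -[X in X + _]/(\sum_(j < n.+1) D j%:Z) -[X in _ + X]/(\sum_(j < n) D (Negz j)).
  (* The height bound puts this level in the range of one of the two sums. *)
  have := height_bound a i; case E: (height a i) => [k|k] hb.
    rewrite [X in _ + X]big1 ?addr0; last by move=> j _; apply: D0; rewrite E.
    have kn : (k < n.+1)%N by lia.
    rewrite (bigD1 (Ordinal kn)) //= big1 ?addr0 // => j /eqP jk; apply: D0.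
    by rewrite E; apply/eqP => -[] jk'; apply: jk; apply: val_inj.
  rewrite [X in X + _]big1 ?add0r; last by move=> j _; apply: D0; rewrite E.
  have kn : (k < n)%N by lia.
  rewrite (bigD1 (Ordinal kn)) //= big1 ?addr0 // => j /eqP jk; apply: D0.
  by rewrite E; apply/eqP => -[] jk'; apply: jk; apply: val_inj.
rewrite /D -[side a (height a i)]/b.
have nE : n = (i + 2 + (n - (i + 2)))%N by lia.
have sw e : side a' (height a i) e = b e (+) ((e == i) || (e == i.+1)).
  exact: side_swap_eq.
set b' := side a' _ in sw *.
have b1 : b i.+1 = b i by exact: side_peak.
have b'i : b' i = ~~ b i by rewrite sw eqxx addbT.
have b'1 : b' i.+1 = ~~ b i by rewrite sw eqxx orbT addbT b1.
have bb' e : e != i -> e != i.+1 -> b e = b' e.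
  by move=> /negbTE e1 /negbTE e2; rewrite sw e1 e2 addbF.
have W0 : W 0%N = 0 by [].
case: ifP => bi.
  (* Removal is insertion read backwards, with [b] and [b'] exchanged. *)
  rewrite -opprB {1 2}nE (@runsum_domino W b' b i _ W0); try by rewrite ?b'i ?b'1 ?b1 ?bi.
    rewrite -(@lrun_ext b b' i); last by move=> e he; apply: bb'; lia.
    rewrite -(@rrun_ext b b' (i + 2) (n - (i+2))); last by move=> e he; apply: bb'; lia.
    rewrite -/l -/r; lia.
  by move=> e _ e1 e2; rewrite bb'.
rewrite {1 2}nE (@runsum_domino W b b' i _ W0) //; try by rewrite ?b'i ?b'1 ?b1 ?bi.
by move=> e _; apply: bb'.
Qed.

(* Vertex [x] lies between the letters [x.-1] and [x]. *)
Definition straight (n : nat) (a : nat -> bool) (x : nat) : bool :=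
  (0 < x < n)%N && (a x.-1 == a x).

(** * Moves of the ends of runs *)

(** At a straight vertex exactly one summand is nonzero, so this is the length of the run with an
    end at [x]. *)
Definition runlen (n : nat) (a : nat -> bool) (x : nat) : nat :=
  (lrun (side a (height a x)) x + rrun (side a (height a x)) x (n - x))%N.

(** At a straight vertex: whether [x] is the right end of its run rather than the left one. *)
Definition closing (a : nat -> bool) (x : nat) : bool := side a (height a x) x.-1.

(** The change of [wt] when a run of length [L > 0] gains two edges, that is [4(n - L)]. [inward] is
    the same quadratic for losing two edges, and the two add up to [-8]. At [L = 2] the true loss is
    larger by [2K]. *)
Definition outward (n L : nat) : int := 2 * (2 * n + 2)%:Z - 4 * L%:Z - 4.
Definition inward (n L : nat) : int := - (2 * (2 * n + 2)%:Z - 4 * L%:Z + 4).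

Definition right_gain n a x : int :=
  if closing a x then outward n (runlen n a x) else inward n (runlen n a x).
Definition left_gain n a x : int :=
  if closing a x then inward n (runlen n a x) else outward n (runlen n a x).

(** Concavity: the shorter run gains at least what the longer one loses. *)
Lemma nested_gain n L L' : (L < L')%N -> 0 <= outward n L + inward n L'.+1.
Proof. by rewrite /outward /inward; lia. Qed.

Lemma straight_side n a x : (0 < x < n)%N ->
  straight n a x = (side a (height a x) x.-1 != side a (height a x) x).
Proof.
rewrite /straight; case: x => // x xn; rewrite xn /= /side /low /=.
by case: (a x); case: (a x.+1); case: (0 <= _) => /=; lia.
Qed.

Lemma lrun_gt0 b p : (0 < lrun b p)%N = (0 < p)%N && b p.-1.
Proof. by case: p => //= p; case: (b p). Qed.

Lemma rrun_gt0 b p k : (0 < rrun b p k)%N = (0 < k)%N && b p.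
Proof. by case: k => //= k; case: (b p). Qed.

(** A straight [i] jumps to [i.+2], and a straight [i.+2] to [i]. Deleting a run of length 2 or
    merging two runs lowers the potential further than the separate moves would. *)
Lemma flip_gain n a i : (i.+1 < n)%N -> a i != a i.+1 ->
  straight n a i || straight n a i.+2 ->
  potential n (fun x => a (swapi i x)) - potential n a <=
  (straight n a i)%:Z * right_gain n a i
  + (straight n a i.+2)%:Z * left_gain n a i.+2.
Proof.
move=> in_ ai; rewrite potential_swap //.
have hE := height_bump ai.
set b := side a _; set l := lrun _ _; set r := rrun _ _ _; set W := wt _.
have b1 : b i.+1 = b i by exact: side_peak.
have Sl : straight n a i = (0 < i)%N && (b i.-1 != b i).
  by case: posnP => [->//|i0]; rewrite straight_side //; lia.
have Sr : straight n a i.+2 = (i.+2 < n)%N && (b i != b i.+2).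
  case: ltnP => [i2|i2]; last by rewrite /straight; lia.
  by rewrite straight_side // hE /= -b1.
have l0 : (0 < l)%N = (0 < i)%N && b i.-1 by exact: lrun_gt0.
have r0 : (0 < r)%N = (i.+2 < n)%N && b i.+2.
  by rewrite /r rrun_gt0 addn2; lia.
have ln : (l <= i)%N by exact: lrun_le.
have rn : (r <= n - (i + 2))%N by exact: rrun_le.
have Ll : runlen n a i = (l + if b i then r + 2 else 0)%N.
  rewrite /runlen -/b -/l; congr addn.
  rewrite (_ : (n - i = (n - (i + 2)).+2)%N) /=; last by lia.
  by rewrite b1 /r addn2; case: (b i) => //; rewrite addn2.
have Lr : runlen n a i.+2 = (r + if b i then l + 2 else 0)%N.
  rewrite /runlen hE -/b addnC /= b1; congr addn.
    by rewrite /r addn2.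
  by case: (b i) => //; rewrite addn2.
have cl : closing a i = b i.-1 by [].
have cr : closing a i.+2 = b i by rewrite /closing hE -/b /= b1.
rewrite /right_gain /left_gain cl cr Ll Lr Sl Sr /outward /inward.
have W0 : W 0%N = 0 by [].
have W2 : W 2%N = 4 * (2 * n + 2)%:Z - 4 by exact: wt_two.
have gl := @wt_grow (2 * n + 2) l; have gr := @wt_grow (2 * n + 2) r.
have gm := @wt_merge (2 * n + 2) l r.
rewrite -/W in gl gr gm.
move: l0 r0 gl gr gm ln rn; clearbody W l r; clear Sl Sr Ll Lr cl cr hE.
case: (b i) => /=; rewrite ?addn0.
  case: (b i.-1); case: (b i.+2); rewrite ?andbT ?andbF //= => l0 r0 gl gr gm ln rn.
  - move=> i2; rewrite i2.
    have r00 : r = 0%N by lia.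
    rewrite r00 addn0 W0; case: (posnP l) => [l00|lp]; last by have := gl lp; lia.
    by rewrite l00 W0 W2; lia.
  - rewrite orbF => i0; rewrite i0.
    have l00 : l = 0%N by lia.
    rewrite l00 !add0n W0; case: (posnP r) => [r00|rp]; last by have := gr rp; lia.
    by rewrite r00 W0 W2; lia.
  (* The run consists of the two flipped edges and is deleted. *)
  - have -> : l = 0%N by lia.
    have -> : r = 0%N by lia.
    by rewrite !W0 W2 => _; case: (0 < i)%N; case: (i.+2 < n)%N; lia.
move=> l0 r0 gl gr gm ln rn.
have -> : (0 < i)%N && (b i.-1 != false) = (0 < l)%N by rewrite l0; case: (b i.-1).
have -> : (i.+2 < n)%N && (false != b i.+2) = (0 < r)%N by rewrite r0; case: (b i.+2).
case: (posnP l) gl gm l0 => [-> _ _ _|lp gl gm /esym/andP[_ ->]].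
  by case: (posnP r) gr => [->|rp gr] //= _; rewrite add0n W0; have := gr isT; lia.
have H := gl isT; case: (posnP r) gr gm => [-> _ _ _|rp gr gm _].
  by rewrite addn0 W0; lia.
by have := gr isT; have := gm isT isT; lia.
Qed.

(** * Blocked moves in a balanced word *)

Section Balanced.
Variables (N : nat) (a : nat -> bool).
Let n := N.+2.
Hypothesis bal : height a n = 0.

(** Here and in [low_last]: the end edges touch the axis, so no run at a level other than 0 contains
    them. *)
Lemma low_first : -1 <= low a 0 <= 0.
Proof. by rewrite /low /=; case: (a 0%N); lia. Qed.

Lemma low_last : -1 <= low a N.+1 <= 0.
Proof. by move: bal; rewrite /low /n /=; case: (a N.+1); lia. Qed.

Lemma low_succ e : low a e - 1 <= low a e.+1 <= low a e + 1.
Proof. by rewrite /low /=; case: (a e); case: (a e.+1); lia. Qed.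

Lemma runlen_le x : (x <= n)%N -> (runlen n a x <= n)%N.
Proof.
move=> xn; rewrite /runlen.
have := lrun_le (side a (height a x)) x; have := rrun_le (side a (height a x)) x (n - x).
lia.
Qed.

Lemma outward_ge0 x : (x <= n)%N -> 0 <= outward n (runlen n a x).
Proof. by move/runlen_le; rewrite /outward; lia. Qed.

(** Balance places the run to the left of this vertex, so the move past the end of the word would be
    outward. [left_gain_first] is the mirror image. *)
Lemma right_gain_last : straight n a N.+1 -> 0 <= right_gain n a N.+1.
Proof.
rewrite /straight /right_gain /closing => /andP[_ /eqP aN].
suff -> : side a (height a N.+1) N.+1.-1 by apply: outward_ge0.
by move: bal aN; rewrite /side /low /n /=; case: (a N); case: (a N.+1) => //= + _; case: (lerP 0 _); lia.
Qed.

Lemma left_gain_first : straight n a 1 -> 0 <= left_gain n a 1.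
Proof.
rewrite /straight /left_gain /closing => /andP[_ /eqP a0].
suff -> : side a (height a 1) 0 = false by apply: outward_ge0.
by rewrite /side /low /=; case: (a 0%N).
Qed.

Lemma adjacent_gain x : straight n a x -> straight n a x.+1 ->
  0 <= right_gain n a x + left_gain n a x.+1.
Proof.
move=> Sx Sx1.
have [xn xn1] : (0 < x)%N /\ (x.+1 < n)%N.
  by move: Sx Sx1; rewrite /straight; lia.
have nx : (n - x = (n - x.+1).+1)%N by lia.
have nx0 : (0 < n - x.+1)%N by lia.
have x0n : (0 < x < n)%N by lia.
have x1n : (0 < x.+1 < n)%N by lia.
have lastE : (x.+1 + (n - x.+1)).-1 = N.+1 by lia.
have ox := @outward_ge0 x ltac:(lia); have ox1 := @outward_ge0 x.+1 ltac:(lia).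
have [ax ax1] : a x.-1 = a x /\ a x = a x.+1.
  by move: Sx Sx1; rewrite /straight => /andP[_ /eqP ->] /andP[_ /eqP /= ->].
set k := height a x.
have kx : height a x.-1 = k - (if a x then 1 else -1).
  by rewrite -ax /k -{2}(prednK xn) /= addrK.
have k1 : height a x.+1 = k + (if a x then 1 else -1) by [].
have lp : low a x.-1 = if a x then k - 1 else k.
  by rewrite /low kx ax; case: (a x); lia.
have lx : low a x = if a x then k else k - 1 by [].
have lx1 : low a x.+1 = if a x then k + 1 else k - 2.
  by rewrite /low k1 -ax1; case: (a x); lia.
have l0 := low_first; have ln := low_last.
set b := side a k; set b' := side a (height a x.+1).
have bE e : b e = if 0 <= k then k <= low a e else low a e < k by [].
have b'E e : b' e = let k' := k + (if a x then 1 else -1) in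
  if 0 <= k' then k' <= low a e else low a e < k' by rewrite /b' k1.
have cx : closing a x = b x.-1 by [].
have cx1 : closing a x.+1 = b' x by [].
have Rx : runlen n a x = (lrun b x + rrun b x (n - x))%N by [].
have Rx1 : runlen n a x.+1 = (lrun b' x.+1 + rrun b' x.+1 (n - x.+1))%N by [].
have bb : b x.-1 != b x by rewrite -(@straight_side n).
have bb' : b' x != b' x.+1 by rewrite -(@straight_side n a x.+1).
rewrite /right_gain /left_gain cx cx1.
have [bx|bx] := boolP (b x.-1); have [b'x|b'x] := boolP (b' x).
(* Both runs lie to the left. That of [x.+1] is edge [x] preceded by a run strictly longer than that
   of [x]. *)
- suff : (lrun b x < lrun b' x)%N.
    move=> H; rewrite Rx Rx1 nx /= b'x.
    rewrite (_ : b x = false); last by move: bb; rewrite bx; case: (b x).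
    rewrite (_ : rrun b' _ _ = 0%N) ?addn0; first exact: nested_gain.
    rewrite -(prednK nx0) /=; move: bb'; rewrite b'x; by case: (b' x.+1).
  move: bx b'x lp lx; rewrite bE b'E; case Eax: (a x) => /= bx b'x lp lx.
    have kn : k + 1 < 0 by clear -bx b'x lp lx; move: bx b'x; rewrite lp lx; do 2![case: ifP => ?]; lia.
    have bE1 e : b e = (low a e < k) by rewrite bE ifN //; clear -kn; lia.
    have b'E1 e : b' e = (low a e < k + 1) by rewrite b'E Eax /= ifN //; clear -kn; lia.
    apply: lrun_nested => [|||e he]; rewrite ?bE1 ?b'E1 //; [by clear -kn lp; lia|by clear -kn l0; lia|].
    have := low_succ e.-1; clear -he; rewrite prednK; lia.
  have kn : 0 <= k - 1 by clear -bx b'x lp lx; move: bx b'x; rewrite lp lx; do 2![case: ifP => ?]; lia.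
  have bE1 e : b e = (k <= low a e) by rewrite bE ifT //; clear -kn; lia.
  have b'E1 e : b' e = (k - 1 <= low a e) by rewrite b'E Eax /= ifT //; clear -kn; lia.
  apply: lrun_nested => [|||e he]; rewrite ?bE1 ?b'E1 //; [by clear -kn lp; lia|by clear -kn l0; lia|].
  have := low_succ e.-1; clear -he; rewrite prednK; lia.
(* The two heights are 0 and -1 in some order, and both moves are outward. *)
- exact: addr_ge0.
(* Impossible: edge [x] would be on the outer side of both of its end levels. *)
- move: bx b'x lp lx; rewrite bE b'E; case Eax: (a x) => /= bx b'x lp lx;
    clear -bx b'x lp lx; move: bx b'x; rewrite lp lx; do 2![case: ifP => ?]; lia.
(* Both runs lie to the right: the mirror image of the first case. *)
suff : (rrun b' x.+1 (n - x.+1) < rrun b x.+1 (n - x.+1))%N.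
  move=> H; rewrite Rx Rx1 nx /= (negbTE b'x).
  rewrite (_ : b x); last by move: bb; rewrite (negbTE bx); case: (b x).
  rewrite (_ : lrun b x = 0%N) ?add0n; first by rewrite addrC; exact: nested_gain.
  by rewrite -(prednK xn) /= (negbTE bx).
move: bx b'x lp lx lx1; rewrite bE b'E; case Eax: (a x) => /= bx b'x lp lx lx1.
  have kn : 0 <= k by clear -bx b'x lp lx; move: bx b'x; rewrite lp lx; do 2![case: ifP => ?]; lia.
  have bE1 e : b e = (k <= low a e) by rewrite bE ifT //; clear -kn; lia.
  have b'E1 e : b' e = (k + 1 <= low a e) by rewrite b'E Eax /= ifT //; clear -kn; lia.
  apply: rrun_nested => [|||e he]; rewrite ?lastE ?bE1 ?b'E1 //; [by clear -kn lx1; lia|by clear -kn ln; lia|].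
  have := low_succ e; clear -he; lia.
have kn : k < 0 by clear -bx b'x lp lx; move: bx b'x; rewrite lp lx; do 2![case: ifP => ?]; lia.
have bE1 e : b e = (low a e < k) by rewrite bE ifN //; clear -kn; lia.
have b'E1 e : b' e = (low a e < k - 1) by rewrite b'E Eax /= ifN //; clear -kn; lia.
apply: rrun_nested => [|||e he]; rewrite ?lastE ?bE1 ?b'E1 //; [by clear -kn lx1; lia|by clear -kn ln; lia|].
have := low_succ e; clear -he; lia.
Qed.

End Balanced.

(** * Total drift over the flips that do not increase E *)

Definition straights (n : nat) (a : nat -> bool) : int :=
  \sum_(x < n) (straight n a x)%:Z.

Lemma sum_delta n i (c : int) :
  \sum_(x < n) ((x == i :> nat) : nat)%:Z * c = ((i < n)%N : nat)%:Z * c.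
Proof.
elim: n => [|n IH]; first by rewrite big_ord0 ltn0 mul0r.
rewrite big_ord_recr /= IH -mulrDl; congr (_ * _); lia.
Qed.

(** Vertex [i.+1] remains a corner; only [i] and [i.+2] are toggled, if they are interior. *)
Lemma straights_swap n a i : (i.+1 < n)%N -> a i != a i.+1 ->
  straights n (fun x => a (swapi i x)) - straights n a =
  ((0 < i)%N : nat)%:Z * (1 - 2 * (straight n a i)%:Z)
  + ((i.+2 < n)%N : nat)%:Z * (1 - 2 * (straight n a i.+2)%:Z).
Proof.
move=> in_ ai; rewrite /straights -sumrB.
pose c1 := ((0 < i)%N : nat)%:Z * (1 - 2 * (straight n a i)%:Z).
pose c2 : int := 1 - 2 * (straight n a i.+2)%:Z.
rewrite -/c1 -/c2 -(sum_delta n i.+2 c2).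
have -> : c1 = ((i < n)%N : nat)%:Z * c1 by rewrite (ltnW in_) mul1r.
rewrite -sum_delta -big_split /=; apply: eq_bigr => x _.
rewrite /c1 /c2 /straight /swapi; have xn := ltn_ord x.
move: (nat_of_ord x) xn => {}x xn.
case: (eqVneq x i) => [->|xi].
  rewrite (ltnW in_) !andbT; case: (posnP i) => [->|i0] /=; first by rewrite !mul0r mulr0.
  have -> : (i.-1 == i) = false by lia.
  have -> : (i.-1 == i.+1) = false by lia.
  have -> : (i == i.+2) = false by lia.
  by rewrite mul0r addr0; move: ai; case: (a i); case: (a i.+1); case: (a i.-1).
case: (eqVneq x i.+1) => [->|xi1] /=.
  rewrite eqxx (_ : (i.+1 == i.+2) = false); last by lia.
  by rewrite !mul0r addr0 eq_sym subrr.
case: (eqVneq x i.+2) xn => [-> xn|xi2 xn] /=.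
  rewrite eqxx (_ : (i.+1 == i) = false); last by lia.
  rewrite xn mul0r add0r /=.
  by move: ai; case: (a i); case: (a i.+1); case: (a i.+2).
case: (posnP x) => [->|x0]; [by rewrite !mul0r|rewrite xn /=].
have -> : (x.-1 == i) = false by lia.
have -> : (x.-1 == i.+1) = false by lia.
by rewrite !mul0r subrr.
Qed.

Definition good n a i := (a i != a i.+1) && (straight n a i || straight n a i.+2).

(** As [2 < n], one of the two toggled vertices is interior, so a flip with neither of them straight
    creates a mismatch. *)
Lemma good_straights n a i : (2 < n)%N -> (i.+1 < n)%N -> a i != a i.+1 ->
  (straights n (fun x => a (swapi i x)) <= straights n a) =
  straight n a i || straight n a i.+2.
Proof.
move=> n2 in_ ai; rewrite -subr_le0 straights_swap //.
have [s1 s2] : (straight n a i -> (0 < i)%N) /\ (straight n a i.+2 -> (i.+2 < n)%N).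
  by rewrite /straight; split; lia.
move: s1 s2; case: (straight n a i); case: (straight n a i.+2) => s1 s2 /=; lia.
Qed.

(* Summation by parts: a jump of a straight vertex is only prevented by an
   adjacent straight vertex or by an end of the word. *)
Lemma sum_gains (p : nat -> bool) (r l : nat -> int) N : p 0%N = false -> p N.+2 = false ->
  \sum_(i < N.+1) ((p i && ~~ p i.+1)%:Z * r i + (p i.+2 && ~~ p i.+1)%:Z * l i.+2)
  + \sum_(i < N.+1) (p i.+1 && p i.+2)%:Z * (r i.+1 + l i.+2)
  + (p N.+1)%:Z * r N.+1 + (p 1%N)%:Z * l 1%N
  = \sum_(x < N.+2) (p x)%:Z * (r x + l x).
Proof.
move=> p0 pN.
(* With correction terms for a true [p N.+2] the identity passes through the induction on [N]. *)
suff -> : \sum_(i < N.+1) ((p i && ~~ p i.+1)%:Z * r i + (p i.+2 && ~~ p i.+1)%:Z * l i.+2)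
  + \sum_(i < N.+1) (p i.+1 && p i.+2)%:Z * (r i.+1 + l i.+2)
  + (p N.+1)%:Z * r N.+1 + (p 1%N)%:Z * l 1%N
  = \sum_(x < N.+2) (p x)%:Z * (r x + l x) + (p N.+2)%:Z * l N.+2
    + (p N.+1 && p N.+2)%:Z * r N.+1.
  by rewrite pN andbF !mul0r !addr0.
elim: N {pN} => [|N IH].
  rewrite !big_ord_recr !big_ord0 /= p0.
  by case: (p 1%N); case: (p 2%N) => /=; lia.
rewrite big_ord_recr [X in _ + X + _ + _ = _]big_ord_recr [in RHS]big_ord_recr /=.
move: IH; set s1 := \sum_(i < N.+1) _; set s2 := \sum_(i < N.+1) _; set s3 := \sum_(i < N.+2) _.
by clearbody s1 s2 s3; case: (p N.+1); case: (p N.+2); case: (p N.+3) => /=; lia.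
Qed.

(** All moves together give [-8] per straight vertex; by [sum_gains] this splits into the possible
    moves and the blocked ones, and the latter are nonnegative. *)
Lemma potential_drift n a : (1 < n)%N -> height a n = 0 ->
  \sum_(i < n.-1 | good n a i) (potential n (fun x => a (swapi i x)) - potential n a)
  <= - 8 * straights n a.
Proof.
case: n => [|[|N]] // _ bal; set n := N.+2.
have p0 : straight n a 0 = false by [].
have pN : straight n a N.+2 = false by rewrite /straight; lia.
have -> : - 8 * straights n a =
  \sum_(x < n) (straight n a x)%:Z * (right_gain n a x + left_gain n a x).
  rewrite /straights mulr_sumr; apply: eq_bigr => x _; rewrite mulrC; congr (_ * _).
  by rewrite /right_gain /left_gain /outward /inward; case: closing; lia.
rewrite -(sum_gains _ _ p0 pN) -!addrA -[X in X <= _]addr0; apply: lerD.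
  rewrite big_mkcond; apply: ler_sum => i _; case: ifP => [/andP[ai g]|].
    have in_ : (i.+1 < n)%N by rewrite ltnS; apply: ltn_ord.
    apply: le_trans (flip_gain in_ ai g) _.
    have -> : straight n a i.+1 = false by rewrite /straight /= (negbTE ai) andbF.
    by rewrite !andbT.
  rewrite /good; have -> : straight n a i.+1 = (a i == a i.+1).
    by rewrite /straight /= ltnS ltn_ord.
  case: (a i == a i.+1) => /=; first by rewrite !andbF !mul0r.
  by move/negbT/norP => [/negbTE -> /negbTE ->]; rewrite !mul0r.
apply: addr_ge0.
  apply: sumr_ge0 => i _.
  case: (boolP (_ && _)) => [/andP[s1 s2]|_]; last by rewrite mul0r.
  by rewrite mul1r; apply: adjacent_gain.
apply: addr_ge0.
  case: (boolP (straight n a N.+1)) => s; last by rewrite mul0r.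
  by rewrite mul1r; apply: right_gain_last.
case: (boolP (straight n a 1)) => s; last by rewrite mul0r.
by rewrite mul1r; apply: left_gain_first.
Qed.

(** Each good flip is charged to a straight vertex at distance one from its centre, hence each
    vertex at most twice. *)
Lemma good_count n a : (1 < n)%N ->
  \sum_(i < n.-1) (good n a i)%:Z <= 2 * straights n a.
Proof.
case: n => [|[|N]] // _; rewrite /straights /=.
set n := N.+2; have pN : straight n a N.+2 = false by rewrite /straight; lia.
have -> : 2 * \sum_(x < n) (straight n a x)%:Z =
   \sum_(i < N.+1) (straight n a i)%:Z + (straight n a N.+1)%:Z +
   (\sum_(i < N.+1) (straight n a i.+2)%:Z + (straight n a 1)%:Z).
  rewrite mulrDl !mul1r {1}big_ord_recr /=; congr (_ + _).
  by rewrite big_ord_recl big_ord_recl [in RHS]big_ord_recr /= pN /straight /= addr0 add0r addrC.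
apply: (@le_trans _ _ (\sum_(i < N.+1) ((straight n a i)%:Z + (straight n a i.+2)%:Z))).
  apply: ler_sum => i _; rewrite /good.
  by case: (_ != _); case: straight; case: straight.
by rewrite big_split; apply: lerD; rewrite lerDl.
Qed.

Lemma potential_ge0 n a : 0 <= potential n a.
Proof.
rewrite /potential; apply: addr_ge0; apply: sumr_ge0 => j _.
  by have /andP[] := @runsum_bounds _ _ (side a j%:Z) n (@wt_step n).
by have /andP[] := @runsum_bounds _ _ (side a (Negz j)) n (@wt_step n).
Qed.

(** An edge is on the outer side of at most [|height| + 1] levels, and at each of them it adds at
    most [3K]. *)
Lemma potential_le n a :
  potential n a <= 3 * (2 * n + 2)%:Z * \sum_(e < n) (`|height a e| + 1).
Proof.
set C := 3 * _.
have rb b : runsum (wt (2 * n + 2)) b n <= C * \sum_(e < n) (b e : nat)%:Z.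
  by have /andP[] := @runsum_bounds _ _ b n (@wt_step n).
apply: (@le_trans _ _ (C * (\sum_(j < n.+1) \sum_(e < n) (side a j%:Z e : nat)%:Z +
   \sum_(j < n) \sum_(e < n) (side a (Negz j) e : nat)%:Z))).
  by rewrite mulrDr !mulr_sumr; apply: lerD; apply: ler_sum => j _; apply: rb.
apply: ler_wpM2l; first by lia.
rewrite exchange_big [X in _ + X]exchange_big -big_split /=; apply: ler_sum => e _.
have c1 m : \sum_(j < m) (side a j%:Z e : nat)%:Z <= Num.max 0 (Num.min m%:Z (low a e + 1)).
  elim: m => [|m IH]; first by rewrite big_ord0; lia.
  rewrite big_ord_recr /=; move: IH; set s := \sum_(_ < _) _; clearbody s.
  by rewrite /side /=; case: leP => /=; lia.
have c2 m : \sum_(j < m) (side a (Negz j) e : nat)%:Z <= Num.max 0 (Num.min m%:Z (- low a e - 1)).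
  elim: m => [|m IH]; first by rewrite big_ord0; lia.
  rewrite big_ord_recr /=; move: IH; set s := \sum_(_ < _) _; clearbody s.
  by rewrite /side /=; case: ltP => /=; lia.
have := c1 n.+1; have := c2 n.
set s1 := \sum_(_ < _) _; set s2 := \sum_(_ < _) _; clearbody s1 s2.
by rewrite /low; case: (a e); lia.
Qed.

(** * Drift of the potential along the cooling process *)

Lemma letter_flip n (w : word n) i : (i.+1 < n)%N ->
  letter (flip w i) = fun x => letter w (swapi i x).
Proof.
move=> in_; apply: funext => x; rewrite /letter.
case: (ltnP x n) => xn; first by rewrite (nth_mktuple _ _ (Ordinal xn)).
rewrite !nth_default ?size_tuple //.
by rewrite /swapi !ifN_eq //; lia.
Qed.

Lemma mism_straights n (w : word n) : (mism w)%:Z = straights n (letter w).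
Proof.
rewrite /mism /straights; case: n w => [|n] w; first by rewrite big_geq // big_ord0.
rewrite big_ord_recl /= add0r big_mkord -natz natr_sum.
by apply: eq_bigr => i _; rewrite natz /straight /= /bump /= add1n ltnS ltn_ord.
Qed.

Definition spin (b : bool) : int := if b then 1 else -1.

Lemma heightE n (w : word n) x : (x <= n)%N ->
  height (letter w) x = \sum_(k < n | (k < x)%N) spin (tnth w k).
Proof.
move=> xn; have -> : height (letter w) x = \sum_(k < x) spin (letter w k).
  by elim: x {xn} => [|x IH]; rewrite ?big_ord0 // big_ord_recr /= IH.
rewrite (big_ord_widen n (fun k => spin (letter w k))) //.
by apply: eq_bigr => k _; rewrite (tnth_nth false).
Qed.

Lemma height_total n (w : word n) :
  height (letter w) n = \sum_(k < n) spin (tnth w k).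
Proof. by rewrite heightE //; apply: eq_bigl => k; rewrite ltn_ord. Qed.

Lemma configsE n (w : word n) : (w \in configs n) = (height (letter w) n == 0).
Proof.
rewrite inE height_total -(big_tuple _ _ w xpredT spin).
suff -> : \sum_(b <- w) spin b = (count id w)%:Z - (count negb w)%:Z by lia.
by elim: (val w) => [|b s IH]; rewrite ?big_nil // big_cons IH; case: b => /=; lia.
Qed.

Lemma flip_configs n (w : word n) i : (i.+1 < n)%N -> letter w i != letter w i.+1 ->
  (flip w i \in configs n) = (w \in configs n).
Proof.
by move=> in_ wi; rewrite !configsE letter_flip // height_swap //; lia.
Qed.

Lemma mem_good_flips n (w : word n) i : i \in good_flips w ->
  (i.+1 < n)%N /\ letter w i != letter w i.+1.
Proof. by rewrite mem_filter mem_iota => /andP[/andP[-> _]]; split=> //; lia. Qed.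

Lemma good_flipsE n (w : word n) : (2 < n)%N ->
  good_flips w = [seq i <- iota 0 n.-1 | good n (letter w) i].
Proof.
move=> n2; apply: eq_in_filter => i; rewrite mem_iota => /andP[_ ni].
rewrite /good; case: (boolP (_ != _)) => //= wi.
rewrite -good_straights //; try lia.
by rewrite -letter_flip -?mism_straights ?lez_nat //; lia.
Qed.

Lemma sum_good_flips (V : zmodType) n (w : word n) (F : nat -> V) : (2 < n)%N ->
  \sum_(i <- good_flips w) F i = \sum_(i < n.-1 | good n (letter w) i) F i.
Proof.
move=> n2; rewrite good_flipsE // big_filter.
by rewrite -(big_mkord (good n (letter w)) F) /index_iota subn0.
Qed.

Lemma flips_drift n (w : word n) : (2 < n)%N -> w \in configs n -> mism w != 0%N ->
  (0 < size (good_flips w))%N /\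
  \sum_(i <- good_flips w) potential n (letter (flip w i))
  <= (potential n (letter w) - 4) * (size (good_flips w))%:Z.
Proof.
move=> n2; rewrite configsE => /eqP wc w0.
have dr := potential_drift (ltnW n2) wc.
have gc := @good_count n (letter w) (ltnW n2).
rewrite -mism_straights in dr gc.
have szE : (size (good_flips w))%:Z = \sum_(i < n.-1) (good n (letter w) i)%:Z.
  have -> : \sum_(i < n.-1) (good n (letter w) i)%:Z =
    \sum_(i < n.-1 | good n (letter w) i) 1.
    by rewrite [RHS]big_mkcond; apply: eq_bigr => i _; case: good.
  by rewrite -(sum_good_flips w (fun=> 1 : int)) // big_const_seq count_predT iter_addr_0 natz.
rewrite -szE in gc.
rewrite -(sum_good_flips w
  (fun i => potential n (fun x => letter w (swapi i x)) - potential n (letter w))) // in dr.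
rewrite sumrB big_const_seq count_predT iter_addr_0 in dr.
have -> : \sum_(i <- good_flips w) potential n (letter (flip w i)) =
  \sum_(i <- good_flips w) potential n (fun x => letter w (swapi i x)).
  rewrite !big_seq; apply: eq_bigr => i /mem_good_flips[? _].
  by rewrite letter_flip.
move: dr; rewrite -mulr_natr natz.
(* Without flips the sum would be 0, against a bound of [-8 E < 0]. Otherwise [-8 E] is shared by at
   most [2 E] flips. *)
case: (posnP (size (good_flips w))) => [/size0nil ->|sz0].
  by rewrite big_nil mulr0 subr0; lia.
move: (\sum_(i <- _) _) (potential _ _) => s p; split=> //.
by rewrite mulrBl; lia.
Qed.

(** * Heights of a uniform configuration *)

Definition permute_word n (s : {perm 'I_n}) (w : word n) : word n := [tuple tnth w (s k) | k < n].

Lemma act_tpermK n (j k : 'I_n) : involutive (permute_word (tperm j k)).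
Proof. by move=> w; apply: eq_from_tnth => i; rewrite !tnth_mktuple tpermK. Qed.

Lemma act_configs n (s : {perm 'I_n}) (w : word n) :
  (permute_word s w \in configs n) = (w \in configs n).
Proof.
rewrite !configsE !height_total [in RHS](reindex_inj (@perm_inj _ s)) /=.
by under eq_bigr do rewrite tnth_mktuple.
Qed.

(** The mean product of two letters times the number of configurations, which keeps it an
    integer. *)
Definition corr n (i j : 'I_n) : int :=
  \sum_(w in configs n) spin (tnth w i) * spin (tnth w j).

Lemma corr_diag n (i : 'I_n) : corr i i = #|configs n|%:Z.
Proof.
rewrite /corr -natz -sumr_const; apply: eq_bigr => w _.
by rewrite /spin; case: (tnth w i).
Qed.

Lemma corr_exchangeable n (i j k : 'I_n) : i != j -> i != k -> corr i j = corr i k.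
Proof.
move=> ij ik; rewrite /corr (reindex_inj (inv_inj (act_tpermK j k))) /=.
apply: eq_big => [w|w _]; first by rewrite act_configs.
by rewrite !tnth_mktuple tpermL tpermD // eq_sym.
Qed.

(** Letters of a configuration sum to 0, hence so does each row of [corr]. Its off-diagonal entries
    are equal and must offset a nonnegative diagonal. *)
Lemma corr_le0 n (i j : 'I_n) : i != j -> corr i j <= 0.
Proof.
move=> ij.
have tot : \sum_(k < n) corr i k = 0.
  rewrite exchange_big /=; apply: big1 => w; rewrite configsE height_total => /eqP w0.
  by rewrite -mulr_sumr w0 mulr0.
rewrite (bigD1 i) //= corr_diag (bigD1 j) 1?eq_sym //= in tot.
rewrite (eq_bigr (fun=> corr i j)) in tot; last first.
  by move=> k /andP[ki _]; apply: corr_exchangeable => //; rewrite eq_sym.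
rewrite sumr_const -mulr_natr natz in tot.
by move: #|configs n| (#|_|) tot => c m; nia.
Qed.

Lemma sum_height_sqr n x : (x <= n)%N ->
  \sum_(w in configs n) height (letter w) x ^+ 2 <= x%:Z * #|configs n|%:Z.
Proof.
move=> xn.
have -> : \sum_(w in configs n) height (letter w) x ^+ 2 =
  \sum_(i < n | (i < x)%N) \sum_(j < n | (j < x)%N) corr i j.
  under [RHS]eq_bigr do rewrite exchange_big.
  rewrite exchange_big /=; apply: eq_bigr => w _; rewrite heightE // expr2 mulr_suml.
  by apply: eq_bigr => i _; rewrite mulr_sumr.
apply: (@le_trans _ _ (\sum_(i < n | (i < x)%N) #|configs n|%:Z)).
  apply: ler_sum => i ix; rewrite (bigD1 i) //= corr_diag gerDl.
  by apply: sumr_le0 => j /andP[_ ji]; apply: corr_le0; rewrite eq_sym.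
rewrite -(big_ord_widen n (fun=> #|configs n|%:Z)) // sumr_const card_ord.
by rewrite -mulr_natl natz.
Qed.

(** * Expected convergence time *)

Section Convergence.
Variables (R : realType) (n : nat).
Hypothesis n2 : (2 < n)%N.
Let phi (v : word n) : R := (potential n (letter v))%:~R.

Lemma phi_ge0 v : 0 <= phi v.
Proof. by rewrite ler0z potential_ge0. Qed.

Lemma trans_ge0 (u v : word n) : 0 <= trans R u v.
Proof. by rewrite /trans; case: ifP => _ //; rewrite divr_ge0. Qed.

Lemma surv_ge0 t (w v : word n) : 0 <= surv R t w v.
Proof.
elim: t v => [|t IH] v //=; apply: mulr_ge0 => //; apply: sumr_ge0 => u _.
by rewrite mulr_ge0 // trans_ge0.
Qed.

Lemma surv_mism0 t (w v : word n) : mism v = 0%N -> surv R t w v = 0.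
Proof. by case: t => [|t] /= ->; rewrite ?andbF ?eqxx ?mul0r. Qed.

Lemma trans_configs (u v : word n) :
  u \in configs n -> v \notin configs n -> trans R u v = 0.
Proof.
move=> uc vc; rewrite /trans; case: ifP => _.
  by case: eqP => // uv; rewrite uv (negbTE vc) in uc.
rewrite (_ : count _ _ = 0%N) ?mul0r //; apply/eqP; rewrite -leqn0 leqNgt -has_count.
apply/hasPn => i /mem_good_flips[in_ ui]; apply: contra vc => /eqP <-.
by rewrite flip_configs.
Qed.

Lemma surv_configs t (w v : word n) :
  w \in configs n -> v \notin configs n -> surv R t w v = 0.
Proof.
move=> wc; elim: t v => [|t IH] v vc /=.
  by case: eqP => // vw; rewrite vw wc in vc.
rewrite big1 ?mulr0 // => u _; case: (boolP (u \in configs n)) => uc.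
  by rewrite (trans_configs uc vc) mulr0.
by rewrite IH // mul0r.
Qed.

Lemma trans_drift (u : word n) : u \in configs n -> mism u != 0%N ->
  \sum_v trans R u v * phi v <= phi u - 4.
Proof.
move=> uc u0; have [sz0 dr] := flips_drift n2 uc u0.
rewrite /trans (negbTE u0) eqn0Ngt sz0 /=.
have szR : 0 < (size (good_flips u))%:R :> R by rewrite ltr0n.
(* Regroups the target words by the flips that lead to them. *)
have -> : \sum_v (count (fun i => flip u i == v) (good_flips u))%:R
     / (size (good_flips u))%:R * phi v =
  (\sum_(i <- good_flips u) phi (flip u i)) / (size (good_flips u))%:R.
  rewrite mulr_suml.
  rewrite [RHS](eq_bigr (fun i => \sum_(v : word n) (flip u i == v)%:R *
     (phi v / (size (good_flips u))%:R))); last first.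
    move=> i _; rewrite (bigD1 (flip u i)) //= eqxx mul1r big1 ?addr0 // => v.
    by rewrite eq_sym => /negbTE ->; rewrite mul0r.
  rewrite exchange_big /=; apply: eq_bigr => v _.
  rewrite -mulr_suml -mulrA [_^-1 * _]mulrC; congr (_ * _).
  by rewrite -sum1_count natr_sum big_mkcond; apply: eq_bigr => i _; case: eqP.
rewrite ler_pdivrMr //.
move: dr; rewrite -(ler_int R) rmorphM rmorphB /= rmorph_sum /=.
by rewrite -pmulrn.
Qed.

(** A telescoped supermartingale bound: each step taken before convergence costs 4 in mean. *)
Lemma tail_potential (w : word n) m : w \in configs n ->
  4 * \sum_(0 <= t < m) tail_prob R t w + \sum_v surv R m w v * phi v <= phi w.
Proof.
move=> wc; elim: m => [|m IH].
  rewrite big_geq // mulr0 add0r (bigD1 w) //= big1 ?addr0.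
    by rewrite eqxx; case: (_ != _); rewrite ?mul1r ?mul0r ?phi_ge0.
  by move=> v /negbTE ->; rewrite mul0r.
apply: le_trans IH; rewrite big_nat_recr //= mulrDr -addrA lerD2l.
apply: (@le_trans _ _ (4 * tail_prob R m w +
  \sum_u surv R m w u * \sum_v trans R u v * phi v)).
  (* The indicator of not having converged is bounded by 1, as [phi] is nonnegative. *)
  rewrite lerD2l.
  under [leRHS]eq_bigr do rewrite mulr_sumr.
  rewrite exchange_big /=; apply: ler_sum => v _.
  under [leRHS]eq_bigr do rewrite mulrA.
  rewrite -mulr_suml; apply: ler_wpM2r; first exact: phi_ge0.
  rewrite -[leRHS]mul1r; apply: ler_wpM2r; last by case: (_ != _).
  by apply: sumr_ge0 => u _; rewrite mulr_ge0 ?surv_ge0 ?trans_ge0.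
rewrite /tail_prob mulr_sumr -big_split /=; apply: ler_sum => u _.
rewrite mulrC -mulrDr.
case: (eqVneq (mism u) 0%N) => [u0|u0]; first by rewrite surv_mism0 // !mul0r.
case: (boolP (u \in configs n)) => uc; last by rewrite surv_configs // !mul0r.
by apply: ler_wpM2l; [exact: surv_ge0 | rewrite addrC -lerBrDr trans_drift].
Qed.

Lemma exp_time_le (w : word n) : w \in configs n ->
  (exp_time R w <= (phi w / 4)%:E)%E.
Proof.
move=> wc; apply: lime_le.
  by apply: is_cvg_nneseries => t _ _; rewrite lee_fin; apply: sumr_ge0 => v _; exact: surv_ge0.
near=> m; rewrite sumEFin lee_fin ler_pdivlMr // mulrC.
apply: le_trans (tail_potential m wc); rewrite lerDl; apply: sumr_ge0 => v _.
by rewrite mulr_ge0 ?surv_ge0 ?phi_ge0.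
Unshelve. all: by end_near. Qed.

End Convergence.

(** * Mean potential of a uniform configuration, and the final bound *)

Lemma sum_abs_height (R : realType) n x : (0 < n)%N -> (x <= n)%N ->
  \sum_(w in configs n) (`|height (letter w) x|)%:~R
  <= Num.sqrt n%:R * #|configs n|%:R :> R.
Proof.
move=> n0 xn; set s := Num.sqrt _; set c := #|configs n|.
have s0 : 0 < s by rewrite sqrtr_gt0 ltr0n.
have ss : s ^+ 2 = n%:R by rewrite sqr_sqrtr.
have sq : \sum_(w in configs n) ((height (letter w) x)%:~R : R) ^+ 2 <= s ^+ 2 * c%:R.
  apply: (@le_trans _ _ ((x%:Z * c%:Z)%:~R)).
    have := sum_height_sqr xn; rewrite -(ler_int R) rmorph_sum /=.
    by under eq_bigr do rewrite rmorphXn.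
  by rewrite rmorphM /= ss; apply: ler_wpM2r; rewrite ?ler0n // ler_nat.
(* With the weight [s = sqrt n] this replaces Cauchy-Schwarz and is linear in the second moment. *)
have amgm (h : R) : `|h| <= (h ^+ 2 / s + s) / 2.
  rewrite ler_pdivlMr // -subr_ge0.
  have -> : h ^+ 2 / s + s - `|h| * 2 = (`|h| - s) ^+ 2 / s.
    by rewrite -(real_normK (num_real h)); field; rewrite gt_eqF.
  by rewrite divr_ge0 ?sqr_ge0 // ltW.
apply: (@le_trans _ _ (\sum_(w in configs n) (((height (letter w) x)%:~R : R) ^+ 2 / s + s) / 2)).
  by apply: ler_sum => w _; rewrite intr_norm amgm.
rewrite -mulr_suml big_split /= -mulr_suml sumr_const -/c -[s *+ c]mulr_natr.
rewrite ler_pdivrMr //.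
apply: (@le_trans _ _ (s ^+ 2 * c%:R / s + s * c%:R)).
  by rewrite lerD2r ler_pM2r ?invr_gt0.
by rewrite le_eqVlt; apply/orP; left; apply/eqP; field; rewrite gt_eqF.
Qed.

Lemma sum_potential (R : realType) n : (2 < n)%N ->
  \sum_(w in configs n) (potential n (letter w))%:~R
  <= 18 * n%:R ^+ 2 * Num.sqrt n%:R * #|configs n|%:R :> R.
Proof.
move=> n2; set s := Num.sqrt _; set c := #|configs n|.
have n1 : 1 <= n%:R :> R by rewrite ler1n; lia.
have s1 : 1 <= s by rewrite -sqrtr1 ler_sqrt // ltr0n; lia.
pose K : R := 3 * (2 * n + 2)%:R.
have K0 : 0 <= K by rewrite mulr_ge0.
apply: (@le_trans _ _ (\sum_(w in configs n)
   K * \sum_(e < n) ((`|height (letter w) e|)%:~R + 1))).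
  apply: ler_sum => w _; have := potential_le n (letter w).
  rewrite -(ler_int R) => /le_trans; apply.
  rewrite !rmorphM /= rmorph_sum /= le_eqVlt; apply/orP; left; apply/eqP.
  by congr (_ * _); apply: eq_bigr => e _; rewrite rmorphD.
rewrite -mulr_sumr exchange_big /=.
(* The extra 1 per edge is absorbed using [1 <= s]. *)
apply: (@le_trans _ _ (K * \sum_(e < n) (2 * s * c%:R))).
  apply: ler_wpM2l => //; apply: ler_sum => e _.
  rewrite big_split /= sumr_const -/c.
  have := @sum_abs_height R n e ltac:(lia) ltac:(exact: ltnW).
  rewrite -/s -/c => h1; have : c%:R <= s * c%:R by rewrite ler_peMl.
  by rewrite -[1 *+ c]/(c%:R) => h2; lra.
rewrite sumr_const card_ord -[_ *+ n]mulr_natr /K.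
rewrite natrD natrM.
(* Here [18 = 9 * 2], where [6n + 6 <= 9n] because [n >= 3]. *)
have -> : 18 * n%:R ^+ 2 * s * c%:R = 9 * n%:R * (2 * s * c%:R * n%:R) by ring.
apply: ler_wpM2r; first by rewrite !mulr_ge0 // ltW // (lt_le_trans _ s1).
have : 3 <= n%:R :> R by rewrite ler_nat.
by lra.
Qed.

(* T_upsilon(n) = O(n^{5/2} ln n) as n -> oo (n even, so that W_n is nonempty). *)
Theorem theorem2 (R : realType) :
  exists (C : R) (N : nat), 0 < C /\
    forall n : nat, (N <= n)%N -> ~~ odd n ->
      (T_unif R n <= (C * (n%:R `^ (5 / 2)) * ln (n%:R))%:E)%E.
Proof.
have l2 : 0 < ln (2 : R) by rewrite ln_gt0 // ltr1n.
(* A quarter of 18 is at most 5, and [ln n / ln 2 >= 1] brings in the logarithm. *)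
exists (5 / ln 2), 3%N; split; first by rewrite divr_gt0.
move=> n n2 _; set c := #|configs n|; set s := Num.sqrt (n%:R : R).
have n0 : 0 < n%:R :> R by rewrite ltr0n; lia.
have s0 : 0 <= s by exact: sqrtr_ge0.
have X0 : 0 <= n%:R ^+ 2 * s by rewrite mulr_ge0 ?exprn_ge0.
have pE : n%:R `^ (5 / 2) = n%:R ^+ 2 * s.
  have -> : 5 / 2 = 2%:R + 2^-1 :> R by field.
  rewrite powRD; last by rewrite gt_eqF ?implybT.
  by rewrite powR_mulrn ?ltW // powR12_sqrt // ltW.
apply: (@le_trans _ _ (\sum_(w in configs n)
   (c%:R^-1 * ((potential n (letter w))%:~R / 4))%:E)%E).
  apply: lee_sum => w wc; rewrite EFinM; apply: lee_wpmul2l.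
    by rewrite lee_fin invr_ge0.
  exact: exp_time_le.
rewrite sumEFin lee_fin -mulr_sumr -mulr_suml pE.
have h : c%:R^-1 * ((\sum_(w in configs n) (potential n (letter w))%:~R) / 4)
   <= 5 * (n%:R ^+ 2 * s).
  apply: (@le_trans _ _ (c%:R^-1 * (18 * n%:R ^+ 2 * s * c%:R / 4))).
    apply: ler_wpM2l; first by rewrite invr_ge0.
    by apply: ler_wpM2r => //; apply: sum_potential.
  (* If [c = 0], its inverse is 0 by convention and the left side vanishes. *)
  have [->|cn0] := eqVneq c 0%N; first by rewrite invr0 mul0r mulr_ge0.
  have -> : c%:R^-1 * (18 * n%:R ^+ 2 * s * c%:R / 4) = 18 / 4 * (n%:R ^+ 2 * s).
    by field; rewrite pnatr_eq0.
  by apply: ler_wpM2r => //; lra.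
apply: le_trans h _.
have -> : 5 / ln 2 * (n%:R ^+ 2 * s) * ln n%:R =
  (ln n%:R / ln 2) * (5 * (n%:R ^+ 2 * s)) by field; rewrite gt_eqF.
rewrite -[leLHS]mul1r; apply: ler_wpM2r; first by rewrite mulr_ge0.
rewrite ler_pdivlMr // mul1r ler_ln ?posrE // ?ltr0n // ler_nat; lia.
Qed.
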